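(* Let $p$ be prime, $m\ge1$, $R=\mathbb Z_{p^m}[x_1^{\pm1},\dots,x_D^{\pm1}]$, let $\mathbf f=(f_1,\dots,f_s)$ be any sequence in $R$ (not necessarily regular) of length $s\ge1$, and let $\mathbf L\in\mathbb Z_{>0}^D$. Then $$\sum_{j=0}^{s}(-1)^jk_j(\mathbf L)=0.$$
   Context: For $\mathbf L=(L_1,\dots,L_D)$, $R_{\mathbf L}:=R/(x_1^{L_1}-1,\dots,x_D^{L_D}-1)$. The Koszul complex $K_\bullet(\mathbf f)$: $K_i(\mathbf f)=\bigwedge^iR^s$, $\partial_i(e_{a_1}\wedge\cdots\wedge e_{a_i})=\sum_{k=1}^i(-1)^{k-1}f_{a_k}e_{a_1}\wedge\cdots\widehat{e_{a_k}}\cdots\wedge e_{a_i}$; $K_\bullet(\mathbf f;R_{\mathbf L}):=K_\bullet(\mathbf f)\otimes_RR_{\mathbf L}$. Set $\mathcal H_j^Z(\mathbf L):=H_j(K_\bullet(\mathbf f;R_{\mathbf L}))$ (a finite group) and $k_j(\mathbf L):=\log_p|\mathcal H_j^Z(\mathbf L)|$. *)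

(* Defs.v *)
From HB Require Import structures.
From mathcomp Require Import all_boot all_order all_fingroup all_algebra.
From mathcomp Require Import finmap monalg.
From mathcomp Require Import boolp reals exp.

Set Implicit Arguments.
Unset Strict Implicit.
Unset Printing Implicit Defensive.

Import Order.TTheory GRing.Theory Num.Theory.
Local Open Scope ring_scope.

(* Laurent polynomials in D variables: finitely supported functions on Z^D,
   with convolution.  (monalg has the additive structure for any choiceType of
   exponents, but its product excludes exponent monoids with inverses.) *)
Definition laurent (A : comNzRingType) (D : nat) : Type :=
  {malg A[{ffun 'I_D -> int}]}.

Section LaurentRing.
Variables (A : comNzRingType) (D : nat).
Local Notation K := {ffun 'I_D -> int}.
Local Notation R := (laurent A D).
Implicit Types (g : R) (k : K) (c : A).

HB.instance Definition _ := GRing.Zmodule.on R.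

Definition lmonom c k : R := mkmalgU k c.

Definition lone : R := lmonom 1 0.

Definition lmul (g1 g2 : R) : R :=
  \sum_(k1 <- msupp g1) \sum_(k2 <- msupp g2)
     lmonom (mcoeff k1 g1 * mcoeff k2 g2) (k1 + k2).

Lemma lmonom0 k : lmonom 0 k = 0.
Proof. exact: monalgU0. Qed.

Lemma lmonomD k : {morph lmonom^~ k : x y / x + y}.
Proof. by move=> x y; exact: monalgUD. Qed.

Lemma laurentE g : g = \sum_(k <- msupp g) lmonom (mcoeff k g) k.
Proof. exact: monalgE. Qed.

Lemma laurent_ind (P : R -> Prop) :
  P 0 -> (forall g1 g2, P g1 -> P g2 -> P (g1 + g2)) ->
  (forall c k, P (lmonom c k)) -> forall g, P g.
Proof.
by move=> P0 PD PU g; rewrite [g]laurentE; apply: big_rec => // k g' _; exact: PD.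
Qed.

Lemma lmulEw (d1 d2 : {fset K}) g1 g2 :
  (msupp g1 `<=` d1)%fset -> (msupp g2 `<=` d2)%fset ->
  lmul g1 g2 = \sum_(k1 <- d1) \sum_(k2 <- d2)
     lmonom (mcoeff k1 g1 * mcoeff k2 g2) (k1 + k2).
Proof.
move=> le1 le2; rewrite /lmul (big_fset_incl _ le1) /=.
  apply/eq_bigr=> k1 _; apply/big_fset_incl => // k _ /mcoeff_outdom ->.
  by rewrite mulr0 lmonom0.
move=> k _ /mcoeff_outdom g1k.
by rewrite big1 => // k' _; rewrite g1k mul0r lmonom0.
Qed.

Lemma lmulC : commutative lmul.
Proof.
move=> g1 g2; rewrite /lmul exchange_big; apply: eq_bigr => k1 _.
by apply: eq_bigr => k2 _; rewrite mulrC [k1 + k2]addrC.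
Qed.

Lemma lmulDl : left_distributive lmul +%R.
Proof.
move=> g1 g2 g.
rewrite [in RHS](lmulEw (fsubsetUl _ (msupp g2)) (fsubset_refl _)).
rewrite [in RHS](lmulEw (fsubsetUr (msupp g1) _) (fsubset_refl _)).
rewrite (lmulEw (msuppD_le _ _) (fsubset_refl _)).
rewrite -big_split /=; apply/eq_bigr=> k1 _.
rewrite -big_split /=; apply/eq_bigr=> k2 _.
by rewrite mcoeffD mulrDl lmonomD.
Qed.

Lemma lmul0l g : lmul 0 g = 0.
Proof. by rewrite /lmul msupp0 big_seq_fset0. Qed.

Lemma lmulDr : right_distributive lmul +%R.
Proof. by move=> g g1 g2; rewrite !(lmulC g) lmulDl. Qed.

Lemma lmul0r g : lmul g 0 = 0.
Proof. by rewrite lmulC lmul0l. Qed.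

Lemma lmulUU c1 c2 k1 k2 :
  lmul (lmonom c1 k1) (lmonom c2 k2) = lmonom (c1 * c2) (k1 + k2).
Proof. by rewrite (lmulEw msuppU_le msuppU_le) !big_seq_fset1 !mcoeffUU. Qed.

Lemma lmulA : associative lmul.
Proof.
move=> g1 g2 g3; elim/laurent_ind: g1 => [|g h Hg Hh|c1 k1].
- by rewrite !lmul0l.
- by rewrite !lmulDl Hg Hh.
elim/laurent_ind: g2 => [|g h Hg Hh|c2 k2].
- by rewrite lmul0l !lmul0r lmul0l.
- by rewrite lmulDl !lmulDr lmulDl Hg Hh.
elim/laurent_ind: g3 => [|g h Hg Hh|c3 k3].
- by rewrite !lmul0r.
- by rewrite !lmulDr Hg Hh.
by rewrite !lmulUU mulrA addrA.
Qed.

Lemma lmul1l : left_id lone lmul.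
Proof.
elim/laurent_ind => [|g h Hg Hh|c k]; first exact: lmul0r.
  by rewrite lmulDr Hg Hh.
by rewrite lmulUU mul1r add0r.
Qed.

Lemma lone_neq0 : lone != 0.
Proof.
apply/eqP => /(congr1 (mcoeff 0)).
by rewrite mcoeffUU mcoeff0; apply/eqP/oner_neq0.
Qed.

HB.instance Definition _ := GRing.Zmodule_isComNzRing.Build R
  lmulA lmulC lmul1l lmulDl lone_neq0.

Lemma lmonomM c1 c2 k1 k2 :
  lmonom c1 k1 * lmonom c2 k2 = lmonom (c1 * c2) (k1 + k2).
Proof. exact: lmulUU. Qed.

Definition lvar (i : 'I_D) : R := lmonom 1 [ffun j => (j == i)%:Z].

Lemma lvarX i n : lvar i ^+ n = lmonom 1 [ffun j => ((j == i) * n)%N%:Z].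
Proof.
elim: n => [|n IHn].
  by congr lmonom; apply/ffunP => j; rewrite !ffunE muln0.
rewrite exprS IHn lmonomM mulr1; congr lmonom; apply/ffunP => j.
by rewrite !ffunE mulnS PoszD.
Qed.

(* Sum of the coefficients, i.e. evaluation at (1, ..., 1). *)
Definition laug g : A := \sum_(k <- msupp g) mcoeff k g.

Lemma laugEw (d : {fset K}) g :
  (msupp g `<=` d)%fset -> laug g = \sum_(k <- d) mcoeff k g.
Proof.
by move=> le; rewrite /laug (big_fset_incl _ le) // => k _ /mcoeff_outdom.
Qed.

Lemma laugD : {morph laug : g h / g + h}.
Proof.
move=> g h; rewrite (laugEw (msuppD_le _ _)).
rewrite (laugEw (fsubsetUl _ (msupp h))) (laugEw (fsubsetUr (msupp g) _)).
by rewrite -big_split /=; apply: eq_bigr => k _; rewrite mcoeffD.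
Qed.

Lemma laug0 : laug 0 = 0.
Proof. by rewrite /laug msupp0 big_seq_fset0. Qed.

Lemma laugU c k : laug (lmonom c k) = c.
Proof. by rewrite (laugEw msuppU_le) big_seq_fset1 mcoeffUU. Qed.

Lemma laugM : {morph laug : g h / g * h}.
Proof.
move=> g h; elim/laurent_ind: g => [|g g' Hg Hg'|c k].
- by rewrite mul0r !laug0 mul0r.
- by rewrite mulrDl !laugD Hg Hg' mulrDl.
elim/laurent_ind: h => [|h h' Hh Hh'|c' k'].
- by rewrite mulr0 !laug0 mulr0.
- by rewrite mulrDr !laugD Hh Hh' mulrDr.
by rewrite lmonomM !laugU.
Qed.

End LaurentRing.

Arguments lvar {A D} i.

Definition ideal_gen (R : comNzRingType) (n : nat) (g : 'I_n -> R) : {pred R} :=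
  fun r => `[< exists c : 'I_n -> R, r = \sum_i c i * g i >].

Definition pos_nat := {n : nat | (0 < n)%N}.

Section Period.
Variables (A : comNzRingType) (D : nat) (L : 'I_D -> pos_nat).
Local Notation R := (laurent A D).

Definition period_ideal : {pred R} :=
  ideal_gen (fun i => lvar i ^+ val (L i) - 1).

Lemma period_ideal_closed : idealr_closed period_ideal.
Proof.
split.
- by apply/asboolP; exists (fun=> 0); rewrite big1 // => i _; rewrite mul0r.
- apply/negP => /asboolP[c /(congr1 (@laug A D))].
  rewrite (big_morph _ (@laugD A D) (laug0 A D)) big1.
    by rewrite laugU; apply/eqP/oner_neq0.
  move=> i _; rewrite laugM (_ : @laug A D (lvar i ^+ _ - 1) = 0) ?mulr0 //.
  have := @laugD A D (lvar i ^+ val (L i) - 1) 1.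
  rewrite subrK lvarX !laugU => /eqP; rewrite -subr_eq subrr => /eqP.
  by move <-.
- move=> a u v /asboolP[c ->] /asboolP[e ->]; apply/asboolP.
  exists (fun i => a * c i + e i); rewrite mulr_sumr -big_split /=.
  by apply: eq_bigr => i _; rewrite mulrDl mulrA.
Qed.

HB.instance Definition _ := isIdealr.Build R period_ideal period_ideal_closed.

Definition period_ring : Type := {ideal_quot period_ideal}.

HB.instance Definition _ := GRing.ComNzRing.on period_ring.

Definition period_pi : R -> period_ring := \pi_{ideal_quot period_ideal}%qT.

HB.instance Definition _ := GRing.RMorphism.on period_pi.

End Period.

(* For finite A the quotient is finite: it is spanned over A by the monomials
   with exponents in a box. *)
Section PeriodFinite.
Variables (A : finComNzRingType) (D : nat) (L : 'I_D -> pos_nat).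
Local Notation R := (laurent A D).
Local Notation K := {ffun 'I_D -> int}.
Local Notation pi := (@period_pi A D L).
Let N := (\sum_i val (L i))%N.

Let u (k : K) := pi (lmonom 1 k).

Let uD k1 k2 : u (k1 + k2) = u k1 * u k2.
Proof. by rewrite /u -rmorphM lmonomM mulr1. Qed.

Let u0 : u 0 = 1.
Proof. exact: rmorph1. Qed.

Let period_relation i : pi (lvar i) ^+ val (L i) = 1.
Proof.
apply/eqP; rewrite -rmorphXn -subr_eq0 -(rmorph1 pi) -rmorphB.
rewrite -(rmorph0 pi) -Quotient.idealrBE subr0; apply/asboolP.
exists (fun j => (j == i)%:R); rewrite (bigD1 i) //= eqxx mul1r big1 ?addr0 //.
by move=> j /negbTE ->; rewrite mul0r.
Qed.

Let u_period i (z : int) : u [ffun j => (j == i)%:Z * ((val (L i))%:Z * z)] = 1.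
Proof.
have un (n : nat) : u [ffun j => (j == i)%:Z * ((val (L i))%:Z * n%:Z)] = 1.
  rewrite -[RHS](expr1n _ n) -(period_relation i) -exprM -rmorphXn lvarX /u.
  by congr (pi (lmonom _ _)); apply/ffunP => j; rewrite !ffunE !PoszM.
case: z => n; first exact: un.
rewrite -[LHS]mulr1 -[X in _ * X](un n.+1) -uD -[RHS]u0; congr u; apply/ffunP => j.
by rewrite !ffunE NegzE !mulrN addNr.
Qed.

Let pi_lmonom_mod c (k : K) :
  pi (lmonom c k) = pi (lmonom c [ffun i => (k i %% (val (L i))%:Z)%Z]).
Proof.
set r := finfun _.
have lE k' : pi (lmonom c k') = pi (lmonom c 0) * u k'.
  by rewrite /u -rmorphM lmonomM mulr1 add0r.
rewrite (lE k) (lE r); congr (_ * _).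
pose d i : K := [ffun j => (j == i)%:Z * ((val (L i))%:Z * (k i %/ (val (L i))%:Z)%Z)].
have -> : k = r + \sum_i d i.
  apply/ffunP => j; rewrite !ffunE sum_ffunE (bigD1 j) //= big1 => [|i neq_ij].
    by rewrite ffunE eqxx mul1r addr0 addrC mulrC -divz_eq.
  by rewrite ffunE eq_sym (negbTE neq_ij) mul0r.
rewrite uD (big_morph u uD u0) big1 ?mulr1 // => i _; exact: u_period.
Qed.

Let piD (g h : R) : pi (g + h) = pi g + pi h.
Proof. exact: rmorphD. Qed.

Let combo (c : {ffun {ffun 'I_D -> 'I_N.+1} -> A}) : R :=
  \sum_e lmonom (c e) [ffun i => (nat_of_ord (e i))%:Z].

Let pi_combo (x : period_ring A L) : exists c, pi (combo c) == x.
Proof.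
suff surj (r : R) : exists c, pi (combo c) = pi r.
  by have [c Ec] := surj (generic_quotient.repr x); exists c; rewrite Ec /period_pi reprK.
elim/laurent_ind: r => [|g h [c Ec] [e Ee]|c k].
- exists 0; congr pi; rewrite /combo big1 // => e _.
  by rewrite ffunE lmonom0.
- exists (c + e); rewrite piD -Ec -Ee -piD; congr pi.
  rewrite /combo -big_split; apply: eq_bigr => f _.
  by rewrite ffunE lmonomD.
pose e : {ffun 'I_D -> 'I_N.+1} := [ffun i => inord `|(k i %% (val (L i))%:Z)%Z|%N].
exists [ffun f => if f == e then c else 0]; rewrite pi_lmonom_mod; congr pi.
rewrite /combo (bigD1 e) //= big1 => [|f /negbTE nfe]; last first.
  by rewrite ffunE nfe lmonom0.
rewrite ffunE eqxx addr0; congr lmonom; apply/ffunP => i; rewrite !ffunE.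
have Lgt0 := valP (L i); have L0 : (val (L i))%:Z != 0 by rewrite -lt0n.
rewrite inordK ?gez0_abs ?modz_ge0 // ltnS.
rewrite -lez_nat gez0_abs ?modz_ge0 //.
apply: (le_trans (ltW (ltz_pmod _ _))) => //.
by rewrite lez_nat /N (bigD1 i) //= leq_addr.
Qed.

Let coords (x : period_ring A L) := xchoose (pi_combo x).

Let coordsK : cancel coords (pi \o combo).
Proof. by move=> x; exact: eqP (xchooseP (pi_combo x)). Qed.

HB.instance Definition _ : isCountable (period_ring A L) :=
  CanIsCountable coordsK.
HB.instance Definition _ : isFinite (period_ring A L) := CanIsFinite coordsK.

End PeriodFinite.

(* The basis e_S of the i-th exterior power of R^s is indexed by the subsets
   S = {a_1 < ... < a_i} of 'I_s, in the order of enum. *)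
Definition ext_basis (s i : nat) : {set {set 'I_s}} := [set S : {set 'I_s} | #|S| == i].

Definition ext_rank (s i : nat) : nat := #|ext_basis s i|.

Section Koszul.
Variables (R : comNzRingType) (s : nat) (f : 'I_s -> R).

Definition ext_vec (i : nat) (S : {set 'I_s}) : 'rV[R]_(ext_rank s i) :=
  \row_k (enum_val k == S)%:R.

(* If a = a_k is the k-th element of S, then ext_pos S a = k - 1. *)
Definition ext_pos (S : {set 'I_s}) (a : 'I_s) : nat :=
  #|[set b in S | (b < a)%N]|.

(* \partial_{i+1}(e_S), for #|S| = i+1. *)
Definition koszul_bd (i : nat) (S : {set 'I_s}) : 'rV[R]_(ext_rank s i) :=
  \sum_(a in S) ((-1) ^+ ext_pos S a * f a) *: ext_vec i (S :\ a).

(* \partial_{i+1}, acting on row vectors by right multiplication. *)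
Definition koszul_mx (i : nat) : 'M[R]_(ext_rank s i.+1, ext_rank s i) :=
  \matrix_(k < ext_rank s i.+1) koszul_bd i (enum_val k).

Lemma koszul_mxE i (S : {set 'I_s}) :
  S \in ext_basis s i.+1 -> ext_vec i.+1 S *m koszul_mx i = koszul_bd i S.
Proof.
move=> S_i; rewrite (_ : ext_vec _ S = delta_mx 0 (enum_rank_in S_i S)).
  by rewrite -rowE rowK enum_rankK_in.
apply/rowP => k; rewrite !mxE eqxx /= -(inj_eq enum_val_inj).
by rewrite enum_rankK_in.
Qed.

Lemma ext_posD1 (S : {set 'I_s}) (a b : 'I_s) :
  a \in S -> ext_pos S b = ((a < b)%N + ext_pos (S :\ a) b)%N.
Proof.
move=> aS; rewrite /ext_pos (cardsD1 a) inE aS /=; congr (_ + #|pred_of_set _|)%N.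
by apply/setP => c; rewrite !inE andbA.
Qed.

Lemma koszul_mx_comp0 i : koszul_mx i.+1 *m koszul_mx i = 0.
Proof.
apply/row_matrixP => k; rewrite row_mul rowK row0.
have := enum_valP k; set S := enum_val k; rewrite inE => /eqP cardS.
pose t a b := ((-1) ^+ (ext_pos S a + ext_pos (S :\ a) b) * (f a * f b)) *:
  ext_vec i (S :\ a :\ b).
have -> : koszul_bd i.+1 S *m koszul_mx i =
    \sum_(a in S) \sum_(b in S | b != a) t a b.
  rewrite /koszul_bd mulmx_suml; apply: eq_bigr => a aS.
  rewrite -scalemxAl koszul_mxE ?inE; last first.
    by move: cardS; rewrite (cardsD1 a) aS add1n => -[->].
  rewrite /koszul_bd scaler_sumr; apply: eq_big => [b|b _].
    by rewrite !inE andbC.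
  by rewrite scalerA mulrACA -exprD.
have split_ab a : a \in S -> \sum_(b in S | b != a) t a b =
    \sum_(b in S | (b < a)%N) t a b + \sum_(b in S | (a < b)%N) t a b.
  move=> aS; rewrite (bigID (fun b : 'I_s => (b < a)%N)) /=.
  congr (_ + _); apply: eq_bigl => b; rewrite -andbA -val_eqE /=.
    by case: ltngtP; rewrite ?andbF.
  by case: ltngtP; rewrite ?andbF.
have exch : \sum_(a in S) \sum_(b in S | (a < b)%N) t a b =
    \sum_(a in S) \sum_(b in S | (b < a)%N) t b a.
  rewrite (exchange_big_dep (fun b => b \in S)) /=; last by move=> ? ? _ /andP[].
  by apply: eq_bigr => b bS; apply: eq_bigl => a; rewrite bS.
rewrite (eq_bigr _ split_ab) big_split /= exch -big_split big1 // => a aS.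
rewrite -big_split big1 //= => b /andP[bS ltba].
rewrite /t setDDl setUC -setDDl -scalerDl.
rewrite (ext_posD1 a bS) ltba (ext_posD1 b aS) ltnNge (ltnW ltba) /= add0n.
rewrite (mulrC (f b)) -mulrDl [(ext_pos _ b + _)%N]addnC add1n addSn exprS.
by rewrite mulN1r addNr mul0r scale0r.
Qed.

End Koszul.

(* Homology of C (x)_R Q for a complex of free modules R^(n i) with
   differentials d i : R^(n i.+1) -> R^(n i), and a ring morphism phi : R -> Q
   with finite target: tensoring with Q keeps the bases and applies phi to
   the matrices. *)
Section BaseChangeHomology.
Variables (R : comNzRingType) (Q : finComNzRingType) (phi : {rmorphism R -> Q}).
Variables (n : nat -> nat) (d : forall i, 'M[R]_(n i.+1, n i)).

Definition base_change i : 'M[Q]_(n i.+1, n i) := map_mx phi (d i).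

Definition cycles (j : nat) : {set 'rV[Q]_(n j)} :=
  match j with
  | 0 => [set: 'rV[Q]_(n 0)]
  | j'.+1 => [set c | c *m base_change j' == 0]
  end.

Definition boundaries (j : nat) : {set 'rV[Q]_(n j)} :=
  [set c *m base_change j | c : 'rV[Q]_(n j.+1)].

Lemma cycles_group_set j : group_set (cycles j).
Proof.
case: j => [|j]; first exact: groupP.
apply/group_setP; split=> [|x y]; rewrite !inE ?mul0mx //.
by move=> /eqP x0 /eqP y0; rewrite mulmxDl x0 y0 addr0.
Qed.

Lemma boundaries_group_set j : group_set (boundaries j).
Proof.
apply/group_setP; split=> [|x y].
  by apply/imsetP; exists 0; rewrite ?mul0mx.
move=> /imsetP[c _ ->] /imsetP[c' _ ->].
by apply/imsetP; exists (c + c'); rewrite ?mulmxDl.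
Qed.

Canonical cycles_group j := Group (cycles_group_set j).
Canonical boundaries_group j := Group (boundaries_group_set j).

Definition homology (j : nat) : {set coset_of (boundaries j)} :=
  (cycles j / boundaries j)%g.

End BaseChangeHomology.

Definition koszul_homology (A : finComNzRingType) (D s : nat)
    (f : 'I_s -> laurent A D) (L : 'I_D -> pos_nat) (j : nat) :=
  homology (@period_pi A D L) (koszul_mx f) j.

(* log_p |H_j|, as a real number. *)
Definition koszul_log (Rr : realType) (p : nat) (A : finComNzRingType)
    (D s : nat) (f : 'I_s -> laurent A D) (L : 'I_D -> pos_nat) (j : nat) : Rr :=
  ln #|koszul_homology f L j|%:R / ln p%:R.

(* Main.v *)
Require Import Defs.
From HB Require Import structures.
From mathcomp Require Import all_boot all_order all_fingroup all_algebra.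
From mathcomp Require Import reals exp ring.

Set Implicit Arguments.
Unset Strict Implicit.
Unset Printing Implicit Defensive.

Import GRing.Theory Num.Theory.
Local Open Scope ring_scope.

(** This is invariance of the Euler characteristic, in multiplicative form, for a complex of finite
    free modules over the finite ring [Q]. Write Z, B, H for cycles, boundaries and homology. Then
    |H_j| |B_j| = |Z_j| ([card_homology]) and |Z_{j+1}| |B_j| = |Q|^{n_{j+1}} ([card_cyclesS]).
    After taking logarithms, the alternating sum telescopes ([sum_sign_ln_homology]) to that of the
    ranks times ln |Q|, up to one boundary term. For the Koszul complex the ranks are the binomials
    C(s, j), whose alternating sum is (1 - 1)^s = 0, and the boundary term at the top degree is ln
    1. Regularity of the sequence never enters. *)

Lemma sum_sign_bin (A : comNzRingType) (s : nat) :
  (0 < s)%N -> \sum_(0 <= j < s.+1) (-1) ^+ j * 'C(s, j)%:R = 0 :> A.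
Proof.
case: s => // s _; rewrite big_mkord -[RHS](expr0n A s.+1) -[0 in RHS](subrr 1) exprBn.
by apply: eq_bigr => j _; rewrite !expr1n !mulr1 mulr_natr.
Qed.

Lemma ext_rankE (s i : nat) : ext_rank s i = 'C(s, i).
Proof. by rewrite /ext_rank /ext_basis card_draws card_ord. Qed.

Section Euler.
Variables (R : comNzRingType) (Q : finComNzRingType) (phi : {rmorphism R -> Q}).
Variables (n : nat -> nat) (d : forall i, 'M[R]_(n i.+1, n i)).

(** Rank-nullity by counting: the first isomorphism theorem for the differential, viewed as a
    morphism of finite additive groups. *)
Lemma card_cyclesS j :
  (#|cycles phi d j.+1| * #|boundaries phi d j| = #|Q| ^ n j.+1)%N.
Proof.
pose g (c : 'rV[Q]_(n j.+1)) := c *m base_change phi d j.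
have gM : {in [set: 'rV[Q]_(n j.+1)] &, {morph g : x y / (x * y)%g}}.
  by move=> x y _ _; rewrite /g mulmxDl.
pose gm := Morphism gM.
have -> : cycles phi d j.+1 = ('ker gm)%g.
  by apply/setP => c; rewrite !inE.
have -> : boundaries phi d j = (gm @* setT)%g.
  rewrite morphimEdom; apply/setP => x.
  by apply/imsetP/imsetP => -[c _ ->]; exists c; rewrite ?inE.
by rewrite card_morphim setIT Lagrange ?subsetT // cardsT card_mx mul1n.
Qed.

Hypothesis dd0 : forall i, d i.+1 *m d i = 0.

Lemma boundaries_sub_cycles j : boundaries phi d j \subset cycles phi d j.
Proof.
case: j => [|j]; first exact: subsetT.
apply/subsetP => _ /imsetP[c _ ->].
by rewrite inE -mulmxA /base_change -map_mxM dd0 map_mx0 mulmx0.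
Qed.

Lemma card_homology j :
  (#|homology phi d j| * #|boundaries phi d j| = #|cycles phi d j|)%N.
Proof.
(* The group law is addition of row vectors, so everything commutes and the boundaries are
   normal. *)
have nB : cycles phi d j \subset ('N(boundaries phi d j))%g.
  apply: subset_trans (cent_sub _); apply/centsP => x _ y _; exact: addrC.
by rewrite card_quotient // mulnC Lagrange ?boundaries_sub_cycles.
Qed.

Variable Rr : realType.
Local Notation lnn k := (ln (k%:R : Rr)).

(** Truncating at degree [k] leaves a correction, since B_k is the image of the differential out of
    degree k+1, which the sum does not see. *)
Lemma sum_sign_ln_homology k :
  \sum_(0 <= j < k.+1) (-1) ^+ j * lnn #|homology phi d j| =
  (\sum_(0 <= j < k.+1) (-1) ^+ j * (n j)%:R) * lnn #|Q|
    - (-1) ^+ k * lnn #|boundaries phi d k|.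
Proof.
have ln_natM (a b c : nat) : (0 < a)%N -> (0 < b)%N ->
    (a * b)%N = c -> lnn a + lnn b = lnn c.
  by move=> a0 b0 <-; rewrite natrM lnM ?posrE ?ltr0n.
have Q_gt0 : (0 < #|Q|)%N by rewrite (cardD1 0) inE.
have lnQX i : lnn (#|Q| ^ i)%N = i%:R * lnn #|Q|.
  by rewrite natrX lnXn ?ltr0n // mulr_natl.
have lnH j := ln_natM _ _ _ (cardG_gt0 _) (cardG_gt0 _) (card_homology j).
elim: k => [|k IHk].
  (* In degree 0 every chain is a cycle, so |Z_0| = |Q|^{n_0}. *)
  rewrite !big_nat1 !expr0 !mul1r -lnQX; apply/eqP; rewrite eq_sym subr_eq lnH.
  by rewrite cardsT card_mx mul1n.
rewrite big_nat_recr //= IHk [in RHS]big_nat_recr //= exprS mulN1r.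
have lnZ := ln_natM _ _ _ (cardG_gt0 _) (cardG_gt0 _) (card_cyclesS k).
rewrite lnQX in lnZ; have := lnH k.+1.
by move=> /(canRL (addrK _))->; move/(canRL (addrK _)): lnZ => ->; ring.
Qed.

End Euler.

Theorem fact6 (Rr : realType) (p m D s : nat) (hp : prime p) (hm : (1 <= m)%N)
    (hs : (1 <= s)%N) (f : 'I_s -> laurent 'Z_(p ^ m) D) (L : 'I_D -> pos_nat) :
  \sum_(0 <= j < s.+1) (-1) ^+ j * koszul_log Rr p f L j = 0.
Proof.
(* The factor 1 / ln p is common to all terms, so natural logarithms suffice. *)
under eq_bigr do rewrite mulrA.
rewrite -mulr_suml sum_sign_ln_homology; last exact: koszul_mx_comp0.
under eq_bigr do rewrite ext_rankE.
rewrite sum_sign_bin // mul0r sub0r.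
(* The module in degree s+1 has rank C(s, s+1) = 0, so its image is trivial. *)
have -> : #|boundaries (@period_pi _ D L) (koszul_mx f) s| = 1%N.
  apply/eqP/cards1P; exists 0; apply/setP => x; rewrite inE.
  apply/imsetP/eqP => [[c _ ->]|->]; last by exists 0; rewrite ?mul0mx.
  suff -> : c = 0 by rewrite mul0mx.
  by apply/rowP => i; have := ltn_ord i; rewrite [X in (_ < X)%N]ext_rankE bin_small.
by rewrite ln1 mulr0 oppr0 mul0r.
Qed.
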